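(* Let $\alpha,\beta>0$ and let $d\ge 2$ be an integer. Let $c=(c_0,\dots,c_{d-1})\in\mathbb{R}^d$ with $c_0=0$ and $c_i=\alpha$ for $i\ne 0$. For $\eta>0$ let $x^\eta$ be the optimal solution of the entropy-penalized program over the scaled simplex $P=\{x\in\mathbb{R}^d:\sum_i x_i=\beta,\ x\ge 0\}$. For any $\varepsilon>0$, if $\eta\le\frac{\log(\varepsilon d)}{\alpha}$, then $$c^\top x^\eta\ \ge\ (1-\varepsilon)\alpha\beta.$$
   Context: For a nonnegative vector $x$, $H(x)=\sum_i x_i\log\frac1{x_i}$ (natural logarithm, $0\log\frac10=0$). $x^\eta$ is the (unique) minimizer of $c^\top x-\eta^{-1}H(x)$ over $x\in P$. Coordinates are indexed by $0,1,\dots,d-1$. *)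

(* Defs.v *)
From mathcomp Require Import all_boot all_order all_algebra.
From mathcomp Require Import all_classical all_reals all_analysis.

Set Implicit Arguments.
Unset Strict Implicit.
Unset Printing Implicit Defensive.

Import Order.TTheory GRing.Theory Num.Theory.

Local Open Scope classical_set_scope.
Local Open Scope ring_scope.

Definition dotv (R : realType) (d : nat) (c x : 'cV[R]_d) : R :=
  \sum_(i < d) c i 0 * x i 0.

(* The convention 0 * log (1 / 0) = 0 holds because the factor x i 0 vanishes
   and [ln] is a total function. *)
Definition entropy (R : realType) (d : nat) (x : 'cV[R]_d) : R :=
  \sum_(i < d) x i 0 * ln (1 / x i 0).

Definition scaled_simplex (R : realType) (d : nat) (beta : R) :
    set 'cV[R]_d :=
  [set x | \sum_(i < d) x i 0 = beta /\ forall i, 0 <= x i 0].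
Arguments scaled_simplex {R} d beta.

Definition penalized_cost (R : realType) (d : nat) (c : 'cV[R]_d) (eta : R)
    (x : 'cV[R]_d) : R :=
  dotv c x - eta^-1 * entropy x.

Definition penalized_optimum (R : realType) (d : nat) (P : set 'cV[R]_d)
    (c : 'cV[R]_d) (eta : R) (x : 'cV[R]_d) : Prop :=
  P x /\ forall y, P y -> penalized_cost c eta x <= penalized_cost c eta y.

(* Main.v *)
(* The penalized optimum is the softmax point [x_i = beta * e^(- eta c_i) / Z]
   (Gibbs' inequality), so [x_0 = beta * t / (t + d - 1)] with
   [t = e^(eta alpha)]. Since [1 <= t <= eps * d], this gives
   [x_0 <= eps * beta], while [c^T x = alpha * (beta - x_0)]. *)
Require Import Defs.
From mathcomp Require Import all_boot all_order all_algebra.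
From mathcomp Require Import all_classical all_reals all_analysis.
From mathcomp Require Import ring lra.

Set Implicit Arguments.
Unset Strict Implicit.
Unset Printing Implicit Defensive.

Import Order.TTheory GRing.Theory Num.Theory.

Local Open Scope classical_set_scope.
Local Open Scope ring_scope.

(** For [x > 0] this is [x] times the strict bound [1 + u < e^u] at [u = ln y - ln x], which is
    nonzero because [ln] is injective on positive reals. For [x = 0] it reads [- y < 0]. *)
Lemma gibbs_term_lt (R : realType) (x y : R) :
  0 <= x -> 0 < y -> x != y -> x - y < x * (ln x - ln y).
Proof.
rewrite le_eqVlt => /predU1P[<- y0 _|x0 y0 xy].
  by rewrite mul0r sub0r oppr_lt0.
have t0 : ln y - ln x != 0.
  rewrite subr_eq0; apply: contra xy => /eqP lnyx.
  by apply/eqP/ln_inj; rewrite ?posrE.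
have := expR_gt1Dx t0.
rewrite expRD expRN !lnK ?posrE// -(ltr_pM2l x0).
rewrite mulrCA divff ?gt_eqF// mulr1 => h.
by lra.
Qed.

(** Equality case of Gibbs' inequality: the termwise lower bounds [x i - y i] sum to 0, and a single
    index with [x i != y i] would make the relative entropy strictly positive. *)
Lemma gibbs_eq (R : realType) (I : finType) (x y : I -> R) :
  (forall i, 0 <= x i) -> (forall i, 0 < y i) ->
  \sum_i x i = \sum_i y i ->
  \sum_i x i * (ln (x i) - ln (y i)) <= 0 -> x =1 y.
Proof.
move=> x0 y0 sxy gibbs i; apply/eqP; apply: contraTT gibbs => xyi.
have term_le j : x j - y j <= x j * (ln (x j) - ln (y j)).
  have [->|xyj] := eqVneq (x j) (y j); first by rewrite !subrr mulr0.
  exact/ltW/gibbs_term_lt.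
rewrite -ltNge.
have sxy0 : \sum_j (x j - y j) = 0 by rewrite sumrB sxy subrr.
rewrite -[ltLHS]sxy0 (bigD1 i)//= [ltRHS](bigD1 i)//=.
by apply: ltr_leD; [exact: gibbs_term_lt|exact: ler_sum].
Qed.

Lemma penalized_costE (R : realType) (d : nat) (c x : 'cV[R]_d) (eta : R) :
  0 < eta -> (forall i, 0 <= x i 0) ->
  eta * penalized_cost c eta x = \sum_i x i 0 * (ln (x i 0) + eta * c i 0).
Proof.
move=> eta0 x0.
rewrite /penalized_cost mulrBr mulrA divff ?gt_eqF// mul1r /dotv /entropy.
rewrite mulr_sumr -sumrB; apply: eq_bigr => i _.
have := x0 i; rewrite le_eqVlt => /predU1P[<-|xi0]; first by ring.
by rewrite div1r lnV ?posrE//; ring.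
Qed.

(** The softmax point [y] is feasible, and [eta] times the cost of [x] minus that of [y] is the
    relative entropy of [x] with respect to [y]. Optimality of [x] makes it nonpositive, so
    [x = y]. *)
Lemma penalized_optimum_softmax (R : realType) (d : nat) (beta eta : R)
    (c x : 'cV[R]_d) :
  0 < beta -> 0 < eta ->
  penalized_optimum (scaled_simplex d beta) c eta x ->
  forall i, x i 0 =
    beta * expR (- (eta * c i 0)) / \sum_j expR (- (eta * c j 0)).
Proof.
move=> beta0 eta0 [[sx x0] xmin] i0.
set Z := \sum_j _.
have Z0 : 0 < Z.
  rewrite /Z (bigD1 i0)//= ltr_pwDl ?expR_gt0//.
  by apply: sumr_ge0 => j _; exact: expR_ge0.
pose y : 'cV[R]_d := \col_i (beta * expR (- (eta * c i 0)) / Z).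
have yE i : y i 0 = beta / Z * expR (- (eta * c i 0)).
  by rewrite mxE mulrAC.
have bZ0 : 0 < beta / Z by rewrite divr_gt0.
have y0 i : 0 < y i 0 by rewrite yE mulr_gt0 ?expR_gt0.
have lny i : ln (y i 0) = ln (beta / Z) - eta * c i 0.
  by rewrite yE lnM ?posrE ?expR_gt0// expRK.
have sy : \sum_i y i 0 = beta.
  under eq_bigr do rewrite yE.
  by rewrite -mulr_sumr -/Z divfK ?gt_eqF.
have -> : beta * expR (- (eta * c i0 0)) / Z = y i0 0 by rewrite mxE.
apply: (gibbs_eq x0 y0); first by rewrite sx sy.
have Py : scaled_simplex d beta y by split=> // i; exact/ltW.
have := xmin y Py.
rewrite -(ler_pM2l eta0) !penalized_costE//; last by move=> i; exact/ltW.
(* At [y] the bracket is the constant [ln (beta / Z)], so only the total mass matters and the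
   weights [y] may be exchanged for [x]. The two costs can then be subtracted term by term. *)
have -> : \sum_i y i 0 * (ln (y i 0) + eta * c i 0)
        = \sum_i x i 0 * ln (beta / Z).
  under eq_bigr do rewrite lny subrK.
  by rewrite -!mulr_suml sx sy.
rewrite -subr_le0 -sumrB; congr (is_true (_ <= 0)).
by apply: eq_bigr => i _; rewrite lny; ring.
Qed.

Theorem proposition3 (R : realType) (alpha beta : R) (d : nat)
  (halpha : 0 < alpha) (hbeta : 0 < beta) (hd : (2 <= d)%N)
  (c : 'cV[R]_d)
  (hc0 : forall i : 'I_d, nat_of_ord i = 0%N -> c i 0 = 0)
  (hc1 : forall i : 'I_d, nat_of_ord i <> 0%N -> c i 0 = alpha)
  (eta : R) (heta : 0 < eta)
  (xeta : 'cV[R]_d)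
  (hxeta : penalized_optimum (scaled_simplex d beta) c eta xeta)
  (eps : R) (heps : 0 < eps)
  (hle : eta <= ln (eps * d%:R) / alpha) :
  (1 - eps) * (alpha * beta) <= dotv c xeta.
Proof.
case: d hd c hc0 hc1 xeta hxeta hle => // n _ c hc0 hc1 x hx hle.
have c0 : c ord0 0 = 0 by exact: hc0.
have cS (i : 'I_n) : c (lift ord0 i) 0 = alpha by exact: hc1.
have [[sx _] _] := hx.
have cx : dotv c x = alpha * (beta - x ord0 0).
  rewrite /dotv -sx !big_ord_recl c0 mul0r add0r addrC addKr mulr_sumr.
  by apply: eq_bigr => i _; rewrite cS.
suff x0 : x ord0 0 <= eps * beta.
  rewrite cx mulrCA ler_pM2l//; lra.
rewrite (penalized_optimum_softmax hbeta heta hx) big_ord_recl c0.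
under eq_bigr do rewrite cS.
rewrite sumr_const card_ord mulr0 oppr0 expR0 mulr1.
have ea0 : 0 <= eta * alpha by rewrite mulr_ge0 ?ltW.
(* The hypothesis on [eta], multiplied by [alpha] and exponentiated. *)
have t_le : expR (eta * alpha) <= eps * n.+1%:R.
  rewrite -[leRHS]lnK ?posrE ?mulr_gt0 ?ltr0Sn// ler_expR.
  by rewrite -ler_pdivlMr.
have t_ge1 : 1 <= expR (eta * alpha) by rewrite -expR0 ler_expR.
rewrite expRN; set t := expR _ in t_le t_ge1 *.
have t0 : 0 < t by exact: expR_gt0.
have n0 : 0 <= n%:R :> R by exact: ler0n.
have D0 : 0 < 1 + t^-1 *+ n by rewrite ltr_pwDl// mulrn_wge0// invr_ge0 ltW.
(* Clearing denominators turns the goal into [t <= eps * (t + n)]. Since [t <= eps * (n + 1)], it is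
   enough that [1 <= t]. *)
rewrite ler_pdivrMr// mulrAC -[leLHS]mul1r ler_pM2r// -(ler_pM2r t0) mul1r.
apply: (le_trans t_le).
rewrite -mulrA ler_pM2l// mulrDl mul1r mulrnAl mulVf ?gt_eqF//.
by rewrite -natr1; lra.
Qed.
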